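(* Let $f_T$ and $f_S$ be the trace and spectral-norm filtering sensor selection objectives $$f_T(\mathcal{X}) = \sum_{k=0}^{N-1} \theta_k \Big( \operatorname{Tr}[P_{m+k}(\mathcal{X})] - \operatorname{Tr}[P_{m+k|m+k-1}] \Big), \qquad f_S(\mathcal{X}) = \sum_{k=0}^{N-1} \theta_k \Big( \|P_{m+k}(\mathcal{X})\| - \|P_{m+k|m+k-1}\| \Big),$$ where $\mathcal{X} \subseteq \mathcal{O}$ and $P_k(\mathcal{X}) = \big( P_{k|k-1}^{-1} + \sum_{u \in \mathcal{X}} V_u \big)^{-1}$ is the filtering error covariance matrix. Let $\widehat{\mathcal{T}}^\star \in \operatorname{argmin}_{|\mathcal{T}| \leq s} f_T(\mathcal{T})$ and $\widehat{\mathcal{S}}^\star \in \operatorname{argmin}_{|\mathcal{S}| \leq s} f_S(\mathcal{S})$, and let $\widehat{\mathcal{T}}_g$ and $\widehat{\mathcal{S}}_g$ be the $r$-element greedy solutions for $f_T$ and $f_S$ respectively. Then $$f_T(\widehat{\mathcal{T}}_g) \leq \left(1 - e^{-\hat{\alpha} r/s}\right) f_T(\widehat{\mathcal{T}}^\star), \qquad f_S(\widehat{\mathcal{S}}_g) \leq \left(1 - e^{-r/s}\right)\left[ f_S(\widehat{\mathcal{S}}^\star) + s \cdot \hat{\epsilon} \right],$$ for some $\hat{\alpha} \geq \min_{0 \leq k \leq N-1} \hat{\alpha}_k$ and some $\hat{\epsilon} \leq \sum_{k=0}^{N-1} \theta_k \hat{\epsilon}_k$, where $$\hat{\alpha}_k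 = \frac{\lambda_{\min}\big[ P_{m+k|m+k-1}^{-1} \big]}{\lambda_{\max}\big[ P_{m+k|m+k-1}^{-1} + \sum_{u \in \mathcal{O}} V_u \big]}, \qquad \hat{\epsilon}_k = \lambda_{\max}\Big( \sum_{u \in \mathcal{O}} V_u \Big)\, \lambda_{\max}\big( P_{m+k|m+k-1} \big)^2 .$$
   Context: System: states $x_k \in \mathbb{R}^n$ evolve as $x_{k+1} = F x_k + w_k$ with $F \in \mathbb{R}^{n \times n}$; $\mathcal{O}$ is a finite set of sensors, and sensor $u \in \mathcal{O}$ outputs $y_{u,k} = H_u x_k + v_{u,k} \in \mathbb{R}^{p_u}$ with $H_u \in \mathbb{R}^{p_u \times n}$. The noises $w_k$ and $v_{u,k}$ are zero-mean Gaussian with covariances $R_w \succ 0$ and $R_{v,u} \succ 0$ and are independent across times and sensors; the initial state is Gaussian with covariance $\Pi_0 \succ 0$. Filtering covariances: $V_u = H_u^T R_{v,u}^{-1} H_u$. The prediction error covariance is $P_{k|k-1} = F P_{k-1} F^T + R_w$ for $k \geq 1$, with $P_{0|-1} = \Pi_0$, where $P_{k-1} \succeq 0$ is the estimation error covariance matrix at time $k-1$. In the set function $\mathcal{X} \mapsto P_k(\mathcal{X})$, the matrix $P_{k|k-1}$ (equivalently $P_{k-1}$) is a given matrix that does not depend on the argument $\mathcal{X}$. Parameters: $N \geq 1$ and $m \geq 0$ are integers, $\theta_k \geq 0$ for $0 \leq k \leq N-1$, $s \geq 1$ is an integer budget, and $0 \leq r \leq |\mathcal{O}|$ is an integer. Greedy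 solution with $r$ elements for an objective $f$: $\mathcal{G}_0 = \emptyset$, $\mathcal{G}_{j+1} = \mathcal{G}_j \cup \{u\}$ with $u \in \operatorname{argmin}_{w \in \mathcal{O} \setminus \mathcal{G}_j} f(\mathcal{G}_j \cup \{w\})$ (ties broken arbitrarily); the solution is $\mathcal{G}_r$. $\|\cdot\|$ is the spectral norm; $\lambda_{\min}, \lambda_{\max}$ are the smallest and largest eigenvalues. *)

(* Defs.v *)
From HB Require Import structures.
From mathcomp Require Import all_boot all_order all_algebra.
From mathcomp Require Import all_classical all_reals all_analysis.

Set Implicit Arguments.
Unset Strict Implicit.
Unset Printing Implicit Defensive.

Import Order.TTheory GRing.Theory Num.Theory.

Local Open Scope classical_set_scope.
Local Open Scope ring_scope.

Definition psdmx (R : realType) n (A : 'M[R]_n) : Prop :=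
  A \is symmetricmx /\ forall x : 'cV[R]_n, 0 <= (x^T *m A *m x) 0 0.

Definition posdefmx (R : realType) n (A : 'M[R]_n) : Prop :=
  A \is symmetricmx /\
  forall x : 'cV[R]_n, x != 0 -> 0 < (x^T *m A *m x) 0 0.

(* [eigenvalue A a] only sees the real eigenvalues of [A], which for the
   symmetric matrices considered here are all of them.  For [0 < n] the
   supremum and the infimum are those of a finite nonempty set. *)
Definition lambda_max (R : realType) n (A : 'M[R]_n) : R :=
  sup [set a | eigenvalue A a].

Definition lambda_min (R : realType) n (A : 'M[R]_n) : R :=
  inf [set a | eigenvalue A a].

Definition norm2 (R : realType) n (x : 'cV[R]_n) : R :=
  Num.sqrt (\sum_i x i 0 ^+ 2).

(* The norm [`|A|] that the library puts on matrices is the entrywise maximum;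
   this is the operator norm induced by the Euclidean norm. *)
Definition spectral_norm (R : realType) n (A : 'M[R]_n) : R :=
  sup [set norm2 (A *m x) | x in [set x : 'cV[R]_n | norm2 x <= 1]].

(* x_(k+1) = F x_k + w_k and y_(u,k) = H_u x_k + v_(u,k), with Rw, Rv u and Pi0
   the covariances of w_k, v_(u,k) and x_0: the error covariances below depend
   on the noises and on the initial state only through these matrices. *)
Record linear_system (R : realType) (n : nat) (O : finType) := LinearSystem {
  F : 'M[R]_n;
  Rw : 'M[R]_n;
  Pi0 : 'M[R]_n;
  p : O -> nat;
  H : forall u : O, 'M[R]_(p u, n);
  Rv : forall u : O, 'M[R]_(p u);
  Rw_posdef : posdefmx Rw;
  Pi0_posdef : posdefmx Pi0;
  Rv_posdef : forall u : O, posdefmx (Rv u)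
}.

Section Filtering.
Variables (R : realType) (n : nat) (O : finType).
Variable Sys : linear_system R n O.

Definition V (u : O) : 'M[R]_n := (H Sys u)^T *m invmx (Rv Sys u) *m H Sys u.

(* [Pest j] is the given estimation error covariance P_j at time [j], fixed
   independently of the sensor set to be selected. *)
Variable Pest : nat -> 'M[R]_n.

(* P_(k|k-1) *)
Definition Ppred (k : nat) : 'M[R]_n :=
  if k is j.+1 then F Sys *m Pest j *m (F Sys)^T + Rw Sys else Pi0 Sys.

(* P_k(X) *)
Definition Pfilt (k : nat) (X : {set O}) : 'M[R]_n :=
  invmx (invmx (Ppred k) + \sum_(u in X) V u).

Variables (N m : nat) (theta : nat -> R).

Definition f_trace (X : {set O}) : R :=
  \sum_(k < N) theta k * (\tr (Pfilt (m + k) X) - \tr (Ppred (m + k))).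

Definition f_spectral (X : {set O}) : R :=
  \sum_(k < N) theta k *
    (spectral_norm (Pfilt (m + k) X) - spectral_norm (Ppred (m + k))).

Definition alpha_hat (k : nat) : R :=
  lambda_min (invmx (Ppred (m + k))) /
  lambda_max (invmx (Ppred (m + k)) + \sum_u V u).

Definition epsilon_hat (k : nat) : R :=
  lambda_max (\sum_u V u) * lambda_max (Ppred (m + k)) ^+ 2.

End Filtering.

Definition is_argmin_card (R : realType) (O : finType) (f : {set O} -> R)
    (s : nat) (X : {set O}) : Prop :=
  (#|X| <= s)%N /\ forall Y : {set O}, (#|Y| <= s)%N -> f X <= f Y.

(* A relation rather than a function, so that ties are broken arbitrarily. *)
Inductive greedy_solution (R : realType) (O : finType) (f : {set O} -> R) :
    nat -> {set O} -> Prop :=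
| greedy_zero : greedy_solution f 0 finset.set0
| greedy_step (j : nat) (G : {set O}) (u : O) :
    greedy_solution f j G -> u \notin G ->
    (forall w : O, w \notin G -> f (u |: G)%SET <= f (w |: G)%SET) ->
    greedy_solution f j.+1 (u |: G)%SET.

(* Main.v *)
Require Import Defs.
From HB Require Import structures.
From mathcomp Require Import all_boot all_order all_algebra.
From mathcomp Require Import all_classical all_reals all_analysis.
From mathcomp Require Import ring lra.

Set Implicit Arguments.
Unset Strict Implicit.
Unset Printing Implicit Defensive.

Import Order.TTheory GRing.Theory Num.Theory.

Local Open Scope ring_scope.

(** The two bounds hold for different reasons.

    Trace. Write [M] and [N] for the information matrices
    [P_(k|k-1)^-1 + \sum_(u in X) V_u] of two nested sensor sets, so that
    [M <= N] in the Loewner order, and let [Q] and [L] be the noise covariance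
    and the output matrix of one further sensor. By the Woodbury identity
    ([invmx_woodbury]), this sensor lowers the trace of the error covariance
    [M^-1] by [tr (K L M^-2 L^T)], with [K = (Q + L M^-1 L^T)^-1]. Up to the
    factor between [M^-2] and [M^-1], which the extreme eigenvalues control,
    this is [tr (K L M^-1 L^T) = p - tr (Q K)], which decreases as [M] grows.
    Hence the gain at the smaller set is at least [alpha_hat] times the gain at
    the larger one ([trace_gain_ratio], [trace_Pfilt_ratio]). With such a
    ratio [alpha], a greedy step closes at least the fraction [alpha / s] of the
    distance to the optimum ([greedy_bound]); the ratio passes to sums with
    nonnegative weights once [alpha] is the smallest of the [alpha_hat k].

    Spectral norm. Each objective term lies between [- epsilon_hat k] and [0],
    whatever the sensor set. The upper bound is monotonicity
    ([spectral_norm_Pfilt_le]). The lower bound is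
    [P - P W P <= (P^-1 + W)^-1] ([spectral_norm_Ppred_le]), read off the
    variational formula for the form of an inverse ([invmx_variational]). As
    [1 <= s], the bracket [f_S S + s * epsilon] is then nonnegative, while the
    greedy value is nonpositive: the right-hand side dominates by its sign.

    The linear algebra behind both is done with real quadratic forms: an
    eigenvalue attaining the maximum of the form ([max_eigenvalue]), and
    a decomposition of a positive semidefinite matrix as a sum of rank one
    matrices ([psdmx_sum_rank1]), from which the product of two of them has
    nonnegative trace. *)

(** * Quadratic forms *)

Section QuadraticForms.
Variable R : realType.
Implicit Types (n : nat).

Definition dot n (x y : 'cV[R]_n) : R := (x^T *m y) 0 0.

Lemma dotE n (x y : 'cV[R]_n) : dot x y = \sum_i x i 0 * y i 0.
Proof. by rewrite /dot mxE; apply: eq_bigr => i _; rewrite mxE. Qed.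

Lemma dotC n (x y : 'cV[R]_n) : dot x y = dot y x.
Proof. by rewrite !dotE; apply: eq_bigr => i _; rewrite mulrC. Qed.

Lemma dotDr n (x y z : 'cV[R]_n) : dot x (y + z) = dot x y + dot x z.
Proof. by rewrite /dot mulmxDr mxE. Qed.

Lemma dotDl n (x y z : 'cV[R]_n) : dot (x + y) z = dot x z + dot y z.
Proof. by rewrite dotC dotDr !(dotC z). Qed.

Lemma dotZr n a (x y : 'cV[R]_n) : dot x (a *: y) = a * dot x y.
Proof. by rewrite /dot -scalemxAr mxE. Qed.

Lemma dotZl n a (x y : 'cV[R]_n) : dot (a *: x) y = a * dot x y.
Proof. by rewrite dotC dotZr dotC. Qed.

Lemma dotNr n (x y : 'cV[R]_n) : dot x (- y) = - dot x y.
Proof. by rewrite -scaleN1r dotZr mulN1r. Qed.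

Lemma dotNl n (x y : 'cV[R]_n) : dot (- x) y = - dot x y.
Proof. by rewrite dotC dotNr dotC. Qed.

Lemma dot0r n (x : 'cV[R]_n) : dot x 0 = 0.
Proof. by rewrite /dot mulmx0 mxE. Qed.

Lemma dot_mulmx m n (A : 'M[R]_(m, n)) x y :
  dot x (A *m y) = dot (A^T *m x) y.
Proof. by rewrite /dot trmx_mul trmxK mulmxA. Qed.

Lemma dot_ge0 n (x : 'cV[R]_n) : 0 <= dot x x.
Proof. by rewrite dotE sumr_ge0 // => i _; rewrite -expr2 sqr_ge0. Qed.

Lemma dot_eq0 n (x : 'cV[R]_n) : (dot x x == 0) = (x == 0).
Proof.
apply/idP/eqP => [|->]; last by rewrite dot0r.
rewrite dotE psumr_eq0 => [/allP x0|i _]; last by rewrite -expr2 sqr_ge0.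
apply/matrixP => i j; rewrite ord1 mxE.
by have := x0 i (mem_index_enum i); rewrite mulf_eq0 orbb => /eqP.
Qed.

Lemma dot_gt0 n (x : 'cV[R]_n) : x != 0 -> 0 < dot x x.
Proof. by move=> x0; rewrite lt_def dot_eq0 x0 dot_ge0. Qed.

Lemma psdmxP n (A : 'M[R]_n) :
  psdmx A <-> A^T = A /\ forall x, 0 <= dot x (A *m x).
Proof.
split=> [] [symA posA]; split.
- by move: symA; rewrite qualifE /= expr0 scale1r map_mx_id // => /eqP.
- by move=> x; rewrite /dot mulmxA.
- by rewrite qualifE /= expr0 scale1r map_mx_id // symA.
- by move=> x; rewrite -mulmxA; apply: posA.
Qed.

Lemma posdefmxP n (A : 'M[R]_n) :
  posdefmx A <-> A^T = A /\ forall x, x != 0 -> 0 < dot x (A *m x).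
Proof.
split=> [] [symA posA]; split.
- by move: symA; rewrite qualifE /= expr0 scale1r map_mx_id // => /eqP.
- by move=> x x0; rewrite /dot mulmxA posA.
- by rewrite qualifE /= expr0 scale1r map_mx_id // symA.
- by move=> x x0; rewrite -mulmxA; apply: posA.
Qed.

Lemma posdefmx_psd n (A : 'M[R]_n) : posdefmx A -> psdmx A.
Proof.
move=> /posdefmxP[symA posA]; apply/psdmxP; split=> // x.
by have [->|/posA/ltW//] := eqVneq x 0; rewrite mulmx0 dot0r.
Qed.

Lemma psdmx_sym n (A : 'M[R]_n) : psdmx A -> A^T = A.
Proof. by move=> /psdmxP[]. Qed.

Lemma psdmx_ge0 n (A : 'M[R]_n) x : psdmx A -> 0 <= dot x (A *m x).
Proof. by move=> /psdmxP[]. Qed.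

Lemma psdmx0 n : psdmx (0 : 'M[R]_n).
Proof. by apply/psdmxP; split=> [|x]; rewrite ?trmx0 // mul0mx dot0r. Qed.

Lemma psdmxD n (A B : 'M[R]_n) : psdmx A -> psdmx B -> psdmx (A + B).
Proof.
move=> /psdmxP[sA pA] /psdmxP[sB pB]; apply/psdmxP; split=> [|x].
  by rewrite linearD /= sA sB.
by rewrite mulmxDl dotDr addr_ge0.
Qed.

Lemma psdmx_sum n (I : finType) (P : pred I) (A : I -> 'M[R]_n) :
  (forall i, psdmx (A i)) -> psdmx (\sum_(i | P i) A i).
Proof.
by move=> pA; elim/big_rec: _ => [|i x _]; [exact: psdmx0|exact: psdmxD].
Qed.

Lemma posdefmxD n (A B : 'M[R]_n) :
  posdefmx A -> psdmx B -> posdefmx (A + B).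
Proof.
move=> /posdefmxP[sA pA] /psdmxP[sB pB]; apply/posdefmxP; split=> [|x x0].
  by rewrite linearD /= sA sB.
by rewrite mulmxDl dotDr ltr_pwDl ?pA.
Qed.

Lemma psdmx_congr m n (A : 'M[R]_n) (B : 'M[R]_(m, n)) :
  psdmx A -> psdmx (B *m A *m B^T).
Proof.
move=> /psdmxP[sA pA]; apply/psdmxP; split=> [|x].
  by rewrite !trmx_mul trmxK sA mulmxA.
by rewrite -!mulmxA dot_mulmx.
Qed.

Lemma posdefmx_scalar n (c : R) : 0 < c -> posdefmx (c%:M : 'M[R]_n).
Proof.
move=> c0; apply/posdefmxP; split=> [|x x0]; first exact: tr_scalar_mx.
by rewrite mul_scalar_mx dotZr mulr_gt0 ?dot_gt0.
Qed.

(** Expanding the form at [c x - b y], with [b] the mixed term and [c] the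
    value at [y], gives [c (a c - b ^ 2)], with [a] the value at [x]. *)
Lemma psdmx_CauchySchwarz n (A : 'M[R]_n) x y : psdmx A ->
  dot x (A *m y) ^+ 2 <= dot x (A *m x) * dot y (A *m y).
Proof.
move=> psdA; set a := dot x (A *m x); set b := dot x (A *m y).
set c := dot y (A *m y).
have E s t : dot (s *: x + t *: y) (A *m (s *: x + t *: y)) =
    s ^+ 2 * a + (s * t * b) *+ 2 + t ^+ 2 * c.
  rewrite mulmxDr -!scalemxAr !dotDl !dotDr !dotZl !dotZr -/a -/b -/c.
  by rewrite (dot_mulmx A y) psdmx_sym // (dotC _ x) -/b mulr2n; ring.
have pE s t : 0 <= s ^+ 2 * a + (s * t * b) *+ 2 + t ^+ 2 * c.
  by rewrite -E; apply: psdmx_ge0.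
have : 0 <= c by apply: psdmx_ge0.
rewrite le_eqVlt => /orP[/eqP c0|c_gt0].
  (* when the form vanishes at [y], it is affine along [y] *)
  rewrite -c0 mulr0; have [->|b0] := eqVneq b 0; first by rewrite expr0n.
  pose t := - (a + 1) / (b *+ 2).
  have tb : (t * b) *+ 2 = - (a + 1).
    by rewrite -mulrnAr /t mulfVK // mulrn_eq0.
  have := pE 1 t; rewrite -c0 mulr0 addr0 expr1n !mul1r tb opprD addNKr.
  by rewrite oppr_ge0 ler10.
have := pE c (- b).
have -> : c ^+ 2 * a + (c * - b * b) *+ 2 + (- b) ^+ 2 * c =
  c * (a * c - b ^+ 2) by rewrite -mulr_natr; ring.
by rewrite pmulr_rge0 // subr_ge0.
Qed.

Lemma psdmx_kernel n (A : 'M[R]_n) x :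
  psdmx A -> dot x (A *m x) = 0 -> A *m x = 0.
Proof.
move=> psdA x0; apply/eqP; rewrite -dot_eq0.
have := psdmx_CauchySchwarz (A *m x) x psdA.
by rewrite x0 mulr0 -[_ == 0]sqrf_eq0 eq_le sqr_ge0 => ->.
Qed.

Lemma posdefmx_unit n (A : 'M[R]_n) : posdefmx A -> A \in unitmx.
Proof.
move=> /posdefmxP[symA posA]; rewrite -row_free_unit -kermx_eq0.
apply/rowV0P => v /sub_kermxP vA; apply/eqP; apply: contraT => v0.
have : v^T != 0 by apply: contra_neq v0 => v0; rewrite -[v]trmxK v0 trmx0.
by move=> /posA; rewrite -[in A *m _]symA -trmx_mul vA trmx0 dot0r ltxx.
Qed.

Lemma psdmx_unit_posdef n (A : 'M[R]_n) :
  psdmx A -> A \in unitmx -> posdefmx A.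
Proof.
move=> psdA uA; apply/posdefmxP; split=> [|x x0]; first exact: psdmx_sym.
rewrite lt_def psdmx_ge0 // andbT; apply: contra_neq x0 => /psdmx_kernel Ax0.
by rewrite -[x](mulKmx uA) Ax0 // mulmx0.
Qed.

Lemma invmx_sym n (A : 'M[R]_n) : A^T = A -> (invmx A)^T = invmx A.
Proof. by move=> symA; rewrite trmx_inv symA. Qed.

Lemma posdefmx_inv n (A : 'M[R]_n) : posdefmx A -> posdefmx (invmx A).
Proof.
move=> pdA; have uA := posdefmx_unit pdA; apply: psdmx_unit_posdef.
  rewrite -[invmx A]mulmx1 -(mulmxV uA) mulmxA.
  rewrite -[X in _ *m X](@invmx_sym _ A); last exact/psdmx_sym/posdefmx_psd.
  exact/psdmx_congr/posdefmx_psd.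
by rewrite unitmx_inv.
Qed.

Definition loewner n (A B : 'M[R]_n) :=
  forall x : 'cV[R]_n, dot x (A *m x) <= dot x (B *m x).

Lemma psdmxB n (A B : 'M[R]_n) :
  A^T = A -> B^T = B -> loewner A B -> psdmx (B - A).
Proof.
move=> sA sB AB; apply/psdmxP; split=> [|x]; first by rewrite linearB /= sA sB.
by rewrite mulmxBl dotDr dotNr subr_ge0.
Qed.

Lemma loewner_addr n (A B : 'M[R]_n) : psdmx B -> loewner A (A + B).
Proof. by move=> pB x; rewrite mulmxDl dotDr lerDl psdmx_ge0. Qed.

Lemma loewner_congr m n (A B : 'M[R]_n) (C : 'M[R]_(m, n)) :
  loewner A B -> loewner (C *m A *m C^T) (C *m B *m C^T).
Proof. by move=> AB x; rewrite -!mulmxA !(dot_mulmx C). Qed.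

Lemma loewner_scalarP n (A : 'M[R]_n) c :
  loewner A c%:M <-> forall x, dot x (A *m x) <= c * dot x x.
Proof.
by split=> h x; have := h x; rewrite mul_scalar_mx dotZr.
Qed.

(** The form of [invmx A] is the convex conjugate of the form of [A]; the
    inequality is the positivity of the form of [A] at [invmx A *m x - y]. *)
Lemma invmx_variational n (A : 'M[R]_n) x y : posdefmx A ->
  dot x y *+ 2 - dot y (A *m y) <= dot x (invmx A *m x).
Proof.
move=> pdA; have uA := posdefmx_unit pdA; have psdA := posdefmx_psd pdA.
have := psdmx_ge0 (invmx A *m x - y) psdA.
rewrite mulmxBr mulKVmx // !(dotDl, dotDr, dotNl, dotNr).
rewrite (dot_mulmx A (invmx A *m x)) psdmx_sym // mulKVmx //.
by rewrite (dotC _ x) (dotC y x) mulr2n; lra.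
Qed.

(** The variational formula for [invmx A] at [y = invmx B *m x]. *)
Lemma loewner_inv n (A B : 'M[R]_n) : posdefmx A -> posdefmx B ->
  loewner A B -> loewner (invmx B) (invmx A).
Proof.
move=> pdA pdB AB x.
apply: le_trans (invmx_variational x (invmx B *m x) pdA).
have := AB (invmx B *m x); rewrite mulKVmx ?posdefmx_unit //.
by rewrite (dotC _ x) mulr2n; lra.
Qed.

Lemma dot_delta n (A : 'M[R]_n) (i : 'I_n) :
  dot (delta_mx i 0) (A *m delta_mx i 0) = A i i.
Proof.
rewrite -colE dotE (bigD1 i) //= big1 => [|j ji].
  by rewrite !mxE !eqxx mul1r addr0.
by rewrite !mxE eqxx (negbTE ji) mul0r.
Qed.

(** The rank one matrix subtracted is bounded by [A] by Cauchy-Schwarz at [x]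
    and the [i]-th basis vector; when [A i i] is [0], so is its inverse, and
    nothing is subtracted. *)
Lemma psdmx_pivot n (A : 'M[R]_n) (i : 'I_n) : psdmx A ->
  psdmx (A - (A i i)^-1 *: (col i A *m (col i A)^T)).
Proof.
move=> psdA; have symA := psdmx_sym psdA.
apply/psdmxP; split=> [|x].
  by rewrite linearB linearZ /= trmx_mul trmxK symA.
set e : 'cV[R]_n := delta_mx i 0.
have ce : col i A = A *m e by rewrite /e colE.
have Aii : A i i = dot e (A *m e) by rewrite dot_delta.
have -> : dot x ((A - (A i i)^-1 *: (col i A *m (col i A)^T)) *m x) =
    dot x (A *m x) - (A i i)^-1 * dot x (A *m e) ^+ 2.
  rewrite mulmxBl -scalemxAl dotDr dotNr dotZr -mulmxA; congr (_ - _ * _).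
  rewrite -ce [(col i A)^T *m x]mx11_scalar mul_mx_scalar dotZr expr2.
  by rewrite -/(dot _ _) (dotC x).
have CS := psdmx_CauchySchwarz x e psdA; rewrite -Aii in CS.
have : 0 <= A i i by rewrite Aii psdmx_ge0.
rewrite le_eqVlt => /orP[/eqP<-|a0].
  by rewrite invr0 mul0r subr0 psdmx_ge0.
by rewrite subr_ge0 mulrC ler_pdivrMr.
Qed.

(** Symmetric Gaussian elimination: the [k]-th pivot step clears row [k], and
    it leaves the matrix unchanged when the pivot is zero, since the inverse of
    [0] is [0]; the row is then zero already by Cauchy-Schwarz. *)
Lemma psdmx_sum_rank1 n (A : 'M[R]_n) : psdmx A ->
  exists v : 'I_n -> 'cV[R]_n, A = \sum_i v i *m (v i)^T.
Proof.
suff H k : (k <= n)%N -> forall A : 'M[R]_n, psdmx A ->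
    (forall i j : 'I_n, (k <= i)%N -> A i j = 0) ->
    exists v : 'I_n -> 'cV[R]_n, A = \sum_(i < n | (i < k)%N) v i *m (v i)^T.
  move=> psdA; have [|v ->] := H n (leqnn n) A psdA.
    by move=> i j; rewrite leqNgt ltn_ord.
  by exists v; apply: eq_bigl => i; rewrite ltn_ord.
elim: k => [|k IH] kn {}A psdA A0.
  exists (fun=> 0); rewrite big_pred0 //.
  by apply/matrixP => i j; rewrite A0 // mxE.
pose i := Ordinal kn; have symA := psdmx_sym psdA.
have Asym a b : A a b = A b a by rewrite -[in LHS]symA mxE.
have Aii : 0 <= A i i by rewrite -dot_delta psdmx_ge0.
have Apiv j : A i i = 0 -> A i j = 0.
  move=> Aii0.
  suff /matrixP/(_ j 0) : A *m delta_mx i (0 : 'I_1) = 0.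
    by rewrite -colE !mxE Asym.
  by apply: psdmx_kernel => //; rewrite dot_delta.
have [||v vE] := IH _ _ (psdmx_pivot i psdA).
- exact: ltnW.
- move=> a b; rewrite !mxE big_ord1 !mxE leq_eqVlt => /orP[/eqP ka|ka].
    have -> : a = i by apply/val_inj.
    rewrite (Asym b i); have [Aii0|Aii0] := eqVneq (A i i) 0.
      by rewrite (Apiv b) // mulr0 ?mulr0 subrr.
    by rewrite mulrA mulVf // mul1r subrr.
  by rewrite !(A0 a) // mul0r mulr0 subrr.
pose c := Num.sqrt (A i i)^-1.
exists (fun j => if j == i then c *: col i A else v j).
rewrite (bigD1 i) /= ?ltnSn // eqxx.
rewrite -[LHS](subrK ((A i i)^-1 *: (col i A *m (col i A)^T))) vE addrC.
congr (_ + _); last first.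
  rewrite linearZ /= -scalemxAl -scalemxAr scalerA -expr2 sqr_sqrtr //.
  by rewrite invr_ge0.
apply: eq_big => [j|j jk]; last first.
  suff /negbTE-> : j != i by [].
  by apply: contraTneq jk => ->; rewrite ltnn.
by rewrite ltnS -val_eqE /= ltn_neqAle andbC.
Qed.

Lemma psdmx_mxtrace_ge0 n (A B : 'M[R]_n) :
  psdmx A -> psdmx B -> 0 <= \tr (A *m B).
Proof.
move=> /psdmx_sum_rank1[v ->] psdB; rewrite mulmx_suml linear_sum /=.
apply: sumr_ge0 => i _.
rewrite -mulmxA mxtrace_mulC /mxtrace big_ord1 -mulmxA.
exact: psdmx_ge0.
Qed.

Lemma mxtrace_loewner n (C A B : 'M[R]_n) : psdmx C -> A^T = A -> B^T = B ->
  loewner A B -> \tr (C *m A) <= \tr (C *m B).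
Proof.
move=> psdC sA sB AB; rewrite -subr_ge0 -linearB -mulmxBr.
exact/psdmx_mxtrace_ge0/psdmxB.
Qed.

End QuadraticForms.

(** * Extreme eigenvalues and the spectral norm *)

Section Spectrum.
Variable R : realType.
Implicit Types (n : nat).

(** A crude scalar bound: it makes the suprema and infima below finite, and
    bounds an inverse in [max_eigenvalue]. *)
Lemma loewner_entries n (A : 'M[R]_n) :
  loewner A (\sum_i \sum_j `|A i j|)%:M.
Proof.
apply/loewner_scalarP => x.
have xE i : x i 0 ^+ 2 <= dot x x.
  rewrite dotE (bigD1 i) //= -expr2 lerDl sumr_ge0 // => j _.
  by rewrite -expr2 sqr_ge0.
rewrite [leLHS]dotE mulr_suml; apply: ler_sum => i _.
rewrite mxE mulr_sumr mulr_suml; apply: ler_sum => j _.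
apply: le_trans (ler_norm _) _; rewrite mulrCA normrM ler_wpM2l //.
have := xE i; have := xE j; rewrite normrM -(real_normK (num_real (x i 0))).
rewrite -(real_normK (num_real (x j 0))).
have := sqr_ge0 (`|x i 0| - `|x j 0|); nra.
Qed.

Lemma eigenvalue_le n (A : 'M[R]_n) a c : A^T = A ->
  loewner A c%:M -> eigenvalue A a -> a <= c.
Proof.
move=> symA /loewner_scalarP Ac /eigenvalueP[v vA v0].
have w0 : v^T != 0 by apply: contra_neq v0 => v0; rewrite -[v]trmxK v0 trmx0.
have := Ac v^T; rewrite -[in A *m _]symA -trmx_mul vA linearZ /= dotZr.
by rewrite ler_pM2r ?dot_gt0.
Qed.

(** Compactness of the unit sphere is avoided by an order argument.
    The least [c] with [A] below [c%:M] is an eigenvalue: otherwise [c%:M - A]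
    is invertible, hence positive definite and above some [k^-1%:M], and
    [c - k^-1] still bounds [A]. *)
Lemma max_eigenvalue n (A : 'M[R]_n) : (0 < n)%N -> A^T = A ->
  exists2 a, eigenvalue A a & loewner A a%:M.
Proof.
case: n A => // n A _ symA.
pose S : set R := [set c | loewner A c%:M]%classic.
have S0 : (S !=set0)%classic.
  by exists (\sum_i \sum_j `|A i j|); apply: loewner_entries.
have lbS x c : x != 0 -> S c -> dot x (A *m x) / dot x x <= c.
  move=> x0 /loewner_scalarP Sc.
  by rewrite ler_pdivrMr ?dot_gt0.
have hS : has_lbound S.
  pose e : 'cV[R]_n.+1 := const_mx 1.
  have e0 : e != 0.
    by apply/eqP => /matrixP/(_ 0 0)/eqP; rewrite !mxE oner_eq0.
  by exists (dot e (A *m e) / dot e e) => c; apply: lbS.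
pose c := inf S.
have Sc : loewner A c%:M.
  apply/loewner_scalarP => x; have [->|x0] := eqVneq x 0.
    by rewrite mulmx0 !dot0r mulr0.
  rewrite -ler_pdivrMr ?dot_gt0 //; apply: lb_le_inf => // d Sd.
  exact: lbS.
exists c => //; rewrite /eigenvalue /eigenspace kermx_eq0 row_free_unit.
apply/negP => uA.
have pdB : posdefmx (c%:M - A).
  apply: psdmx_unit_posdef; first by apply: psdmxB; rewrite ?tr_scalar_mx.
  by rewrite -[_ - _]opprB -scaleN1r unitmxZ // unitrN1.
pose B := c%:M - A; pose k := \sum_i \sum_j `|invmx B i j| + 1.
have k0 : 0 < k.
  by rewrite ltr_wpDl // sumr_ge0 // => i _; rewrite sumr_ge0.
have kB : loewner (k^-1)%:M B.
  rewrite -[B]invmxK -invmx_scalar; apply: loewner_inv.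
  - exact: posdefmx_inv.
  - exact: posdefmx_scalar.
  have /loewner_scalarP Bk := loewner_entries (invmx B).
  apply/loewner_scalarP => x; apply: le_trans (Bk x) _.
  by rewrite ler_wpM2r ?dot_ge0 // lerDl.
have : c <= c - k^-1.
  apply: ge_inf => //; apply/loewner_scalarP => x.
  have := kB x; rewrite mulmxBl !mul_scalar_mx dotDr dotNr !dotZr.
  by lra.
by rewrite lerBrDr gerDl invr_le0 leNgt k0.
Qed.

Lemma eigenvalue_has_ubound n (A : 'M[R]_n) :
  A^T = A -> has_ubound [set a | eigenvalue A a]%classic.
Proof.
move=> symA; exists (\sum_i \sum_j `|A i j|) => a /=.
exact/eigenvalue_le/loewner_entries.
Qed.

Lemma loewner_lambda_max n (A : 'M[R]_n) :
  A^T = A -> loewner A (lambda_max A)%:M.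
Proof.
case: n A => [|n] A symA; first by move=> x; rewrite [x]flatmx0 !mulmx0.
have [//|a eva /loewner_scalarP Aa] := max_eigenvalue _ symA.
apply/loewner_scalarP => x; apply: le_trans (Aa x) _.
rewrite ler_wpM2r ?dot_ge0 //; apply: ub_le_sup => //.
exact: eigenvalue_has_ubound.
Qed.

Lemma eigenvalueN n (A : 'M[R]_n) a : eigenvalue (- A) a -> eigenvalue A (- a).
Proof.
move=> /eigenvalueP[v vA v0]; apply/eigenvalueP; exists v => //.
by rewrite scaleNr -vA mulmxN opprK.
Qed.

(** The least eigenvalue of [A] is the opposite of the greatest one of [- A]. *)
Lemma lambda_min_loewner n (A : 'M[R]_n) :
  A^T = A -> loewner (lambda_min A)%:M A.
Proof.
case: n A => [|n] A symA; first by move=> x; rewrite [x]flatmx0 !mulmx0.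
have symN : (- A)^T = - A by rewrite linearN /= symA.
have [//|a /eigenvalueN eva /loewner_scalarP Aa] := max_eigenvalue _ symN.
have minA : lambda_min A <= - a.
  apply: ge_inf => //; exists (- a) => b /= evb.
  rewrite lerNl; apply: (eigenvalue_le symN); first exact/loewner_scalarP.
  by apply: eigenvalueN; rewrite opprK.
move=> x; rewrite mul_scalar_mx dotZr.
have := Aa x; rewrite mulNmx dotNr.
have := ler_wpM2r (dot_ge0 x) minA; lra.
Qed.

Lemma psdmx_eigenvalue_ge0 n (A : 'M[R]_n) a :
  psdmx A -> eigenvalue A a -> 0 <= a.
Proof.
move=> psdA eva; rewrite -oppr_le0.
apply: (@eigenvalue_le _ (- A)).
- by rewrite linearN /= psdmx_sym.
- apply/loewner_scalarP => x.
  by rewrite mul0r mulNmx dotNr oppr_le0 psdmx_ge0.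
by apply: eigenvalueN; rewrite opprK.
Qed.

Lemma lambda_max_ge0 n (A : 'M[R]_n) : psdmx A -> 0 <= lambda_max A.
Proof.
move=> psdA; rewrite /lambda_max; set E := (X in sup X).
have [->|/set0P[a Ea]] := eqVneq E set0; first by rewrite sup0.
apply: le_trans (psdmx_eigenvalue_ge0 psdA Ea) _; apply: ub_le_sup => //.
exact/eigenvalue_has_ubound/psdmx_sym.
Qed.

Lemma lambda_min_ge0 n (A : 'M[R]_n) : psdmx A -> 0 <= lambda_min A.
Proof.
move=> psdA; rewrite /lambda_min; set E := (X in inf X).
have [->|/set0P E0] := eqVneq E set0; first by rewrite inf0.
by apply: lb_le_inf => // a; apply: psdmx_eigenvalue_ge0.
Qed.

Lemma norm2E n (x : 'cV[R]_n) : norm2 x = Num.sqrt (dot x x).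
Proof. by rewrite dotE. Qed.

(** Cauchy-Schwarz for the form of [A], at [x] and [A *m x]. *)
Lemma psdmx_sqr_le n (A : 'M[R]_n) c x : psdmx A -> 0 <= c ->
  loewner A c%:M -> dot (A *m x) (A *m x) <= c ^+ 2 * dot x x.
Proof.
move=> psdA c0 /loewner_scalarP Ac.
have CS := psdmx_CauchySchwarz (A *m x) x psdA.
set d := dot (A *m x) (A *m x) in CS *.
have [->|d0] := eqVneq d 0; first by rewrite mulr_ge0 ?sqr_ge0 ?dot_ge0.
have d_gt0 : 0 < d by rewrite lt_def d0 dot_ge0.
rewrite -(ler_pM2l d_gt0) -expr2; apply: le_trans CS _.
have -> : d * (c ^+ 2 * dot x x) = (c * d) * (c * dot x x) by ring.
by apply: ler_pM; rewrite ?psdmx_ge0 ?Ac.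
Qed.

Lemma norm2_mulmx_le n (A : 'M[R]_n) c x : psdmx A -> 0 <= c ->
  loewner A c%:M -> norm2 x <= 1 -> norm2 (A *m x) <= c.
Proof.
move=> psdA c0 Ac; rewrite !norm2E => x1.
have xx1 : dot x x <= 1.
  rewrite -(sqr_sqrtr (dot_ge0 x)) -[leRHS](expr1n R 2).
  by rewrite ler_pXn2r ?nnegrE ?sqrtr_ge0.
rewrite -[leRHS](ger0_norm c0) -sqrtr_sqr ler_wsqrtr //.
apply: le_trans (psdmx_sqr_le x psdA c0 Ac) _.
by rewrite ler_piMr ?sqr_ge0.
Qed.

Lemma spectral_norm_le n (A : 'M[R]_n) c : psdmx A -> 0 <= c ->
  loewner A c%:M -> spectral_norm A <= c.
Proof.
move=> psdA c0 Ac; apply: ge_sup.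
  by exists (norm2 (A *m 0)), 0 => //=; rewrite norm2E dot0r sqrtr0.
by move=> _ [x /= x1 <-]; apply: norm2_mulmx_le.
Qed.

Lemma norm2_le_spectral_norm n (A : 'M[R]_n) x : psdmx A ->
  norm2 x <= 1 -> norm2 (A *m x) <= spectral_norm A.
Proof.
move=> psdA x1; apply: ub_le_sup; last by exists x.
exists (lambda_max A) => _ [y /= y1 <-]; apply: norm2_mulmx_le => //.
- exact: lambda_max_ge0.
- exact/loewner_lambda_max/psdmx_sym.
Qed.

Lemma spectral_norm_ge0 n (A : 'M[R]_n) : psdmx A -> 0 <= spectral_norm A.
Proof.
move=> psdA; apply: le_trans (norm2_le_spectral_norm (x := 0) psdA _).
  exact: sqrtr_ge0.
by rewrite norm2E dot0r sqrtr0.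
Qed.

(** Normalize [x] to reach the unit ball of the supremum, then pass from
    the norm of [A *m x] to the form of [A] by Cauchy-Schwarz. *)
Lemma loewner_spectral_norm n (A : 'M[R]_n) :
  psdmx A -> loewner A (spectral_norm A)%:M.
Proof.
move=> psdA; apply/loewner_scalarP => x.
have [->|x0] := eqVneq x 0; first by rewrite mulmx0 !dot0r mulr0.
have xx := dot_gt0 x0; have N0 := spectral_norm_ge0 psdA.
pose t := Num.sqrt (dot x x); have t0 : 0 < t by rewrite sqrtr_gt0.
have tt : t ^+ 2 = dot x x by rewrite sqr_sqrtr ?dot_ge0.
have /(norm2_le_spectral_norm psdA) : norm2 (t^-1 *: x) <= 1.
  rewrite norm2E dotZl dotZr -tt expr2 mulKf ?gt_eqF // mulVf ?gt_eqF //.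
  by rewrite sqrtr1.
rewrite norm2E -scalemxAr dotZl dotZr mulrA -expr2 sqrtrM ?sqr_ge0 //.
rewrite sqrtr_sqr gtr0_norm ?invr_gt0 // mulrC ler_pdivrMr // => Ax.
have psd1 := posdefmx_psd (posdefmx_scalar n (@ltr01 R)).
have := psdmx_CauchySchwarz x (A *m x) psd1; rewrite !mul1mx => CS.
apply: le_trans (ler_norm _) _; rewrite -sqrtr_sqr.
apply: le_trans (ler_wsqrtr CS) _; rewrite sqrtrM ?dot_ge0 // -/t -tt expr2.
by rewrite mulrA mulrC ler_wpM2r // ltW.
Qed.

End Spectrum.

(** * The trace gain of one observation *)

Lemma invmx_woodbury (K : comUnitRingType) (p n : nat) (M : 'M[K]_n)
    (Q : 'M[K]_p) (L : 'M[K]_(p, n)) :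
  M \in unitmx -> Q \in unitmx ->
  Q + L *m invmx M *m L^T \in unitmx ->
  invmx (M + L^T *m invmx Q *m L) =
  invmx M - invmx M *m L^T *m invmx (Q + L *m invmx M *m L^T)
            *m (L *m invmx M).
Proof.
move=> uM uQ; set G := L *m invmx M *m L^T => uQG.
set X := RHS.
have LX : L *m X = Q *m invmx (Q + G) *m (L *m invmx M).
  have GK : G *m invmx (Q + G) = 1%:M - Q *m invmx (Q + G).
    by rewrite -(mulmxV uQG) mulmxDl addrAC subrr add0r.
  by rewrite /X mulmxBr !mulmxA -/G GK !mulmxBl mul1mx opprB addrC subrK.
have MX : (M + L^T *m invmx Q *m L) *m X = 1%:M.
  rewrite mulmxDl -(mulmxA _ L) LX !mulmxA mulmxKV //.
  by rewrite /X mulmxBr mulmxV // !mulmxA mulmxV // mul1mx subrK.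
have [uMQ _] := mulmx1_unit MX.
by rewrite -[RHS](mulKmx uMQ) MX mulmx1.
Qed.

Section TraceGain.
Variables (R : realType) (p n : nat) (Q : 'M[R]_p) (L : 'M[R]_(p, n)).
Hypothesis posQ : posdefmx Q.

(** The covariance of the innovation of the new sensor when [invmx M] is the
    error covariance before its measurement. *)
Let innov (M : 'M[R]_n) : 'M[R]_p := Q + L *m invmx M *m L^T.

Lemma posdefmx_innov M : posdefmx M -> posdefmx (innov M).
Proof.
move=> pM; apply: posdefmxD => //.
exact/psdmx_congr/posdefmx_psd/posdefmx_inv.
Qed.

Lemma trace_gainE M : posdefmx M ->
  \tr (invmx M) - \tr (invmx (M + L^T *m invmx Q *m L)) =
  \tr (invmx (innov M) *m (L *m (invmx M *m invmx M) *m L^T)).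
Proof.
move=> pM; rewrite invmx_woodbury ?posdefmx_unit //; last exact: posdefmx_innov.
rewrite -/(innov M) linearB /= opprB addrC subrK.
by rewrite -!mulmxA mxtrace_mulC -!mulmxA mxtrace_mulC -!mulmxA.
Qed.

(** The matrix [L *m invmx M *m L^T] is [innov M - Q]; in this form [M] enters
    only through [invmx (innov M)]. *)
Lemma mxtrace_innov M : posdefmx M ->
  \tr (invmx (innov M) *m (L *m invmx M *m L^T)) =
  p%:R - \tr (Q *m invmx (innov M)).
Proof.
move=> pM; rewrite -[L *m _ *m _](addKr Q) -/(innov M) mulmxDr mulmxN.
rewrite mulVmx; last exact/posdefmx_unit/posdefmx_innov.
rewrite addrC linearB /= mxtrace1.
by rewrite (mxtrace_mulC Q).
Qed.

(** As [M] grows, so does [invmx (innov M)], and [mxtrace_innov] decreases. *)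
Lemma mxtrace_innov_le M N : posdefmx M -> posdefmx N -> loewner M N ->
  \tr (invmx (innov N) *m (L *m invmx N *m L^T)) <=
  \tr (invmx (innov M) *m (L *m invmx M *m L^T)).
Proof.
move=> pM pN MN; rewrite !mxtrace_innov // lerD2l lerN2.
have [iM iN] := (posdefmx_innov pM, posdefmx_innov pN).
apply: mxtrace_loewner; first exact: posdefmx_psd.
- exact/psdmx_sym/posdefmx_psd/posdefmx_inv.
- exact/psdmx_sym/posdefmx_psd/posdefmx_inv.
apply: loewner_inv => // x; rewrite !mulmxDl !dotDr lerD2l.
exact/loewner_congr/loewner_inv.
Qed.

Lemma dot_invmx2 (M : 'M[R]_n) x : M^T = M ->
  dot x (invmx M *m invmx M *m x) = dot (invmx M *m x) (invmx M *m x).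
Proof. by move=> sM; rewrite -mulmxA dot_mulmx invmx_sym. Qed.

Lemma dot_invmx (M : 'M[R]_n) x : posdefmx M ->
  dot x (invmx M *m x) = dot (invmx M *m x) (M *m (invmx M *m x)).
Proof. by move=> pM; rewrite mulKVmx ?posdefmx_unit // dotC. Qed.

(** With [y = invmx M *m x], the forms of [M^-2] and [M^-1] at [x] are the
    squared norm of [y] and the form of [M] at [y]: this is where bounds on [M]
    turn the gain, which has [M^-2], into the monotone quantity. *)
Lemma mxtrace_innov_bounds M mu lam : posdefmx M ->
  loewner mu%:M M -> loewner M lam%:M ->
  let gain := \tr (invmx (innov M) *m (L *m (invmx M *m invmx M) *m L^T)) in
  let mid := \tr (invmx (innov M) *m (L *m invmx M *m L^T)) in
  mu * gain <= mid /\ mid <= lam * gain.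
Proof.
move=> pM muM Mlam gain mid; rewrite /gain /mid.
have sM := psdmx_sym (posdefmx_psd pM); have sV := invmx_sym sM.
have psdK : psdmx (invmx (innov M)).
  exact/posdefmx_psd/posdefmx_inv/posdefmx_innov.
have sLL (A : 'M[R]_n) : A^T = A -> (L *m A *m L^T)^T = L *m A *m L^T.
  by move=> sA; rewrite !trmx_mul trmxK sA mulmxA.
have sVV c : (c *: (invmx M *m invmx M))^T = c *: (invmx M *m invmx M).
  by rewrite linearZ /= trmx_mul sV.
have gE c : c * \tr (invmx (innov M) *m (L *m (invmx M *m invmx M) *m L^T)) =
    \tr (invmx (innov M) *m (L *m (c *: (invmx M *m invmx M)) *m L^T)).
  by rewrite -scalemxAr -scalemxAl -scalemxAr mxtraceZ.
have VVE c x : dot x (c *: (invmx M *m invmx M) *m x) =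
    c * dot (invmx M *m x) (invmx M *m x).
  by rewrite -scalemxAl dotZr dot_invmx2.
rewrite !gE; split; apply: mxtrace_loewner => //; rewrite ?sLL //.
- apply: loewner_congr => x; rewrite VVE dot_invmx //.
  by have := muM (invmx M *m x); rewrite mul_scalar_mx dotZr.
- apply: loewner_congr => x; rewrite VVE dot_invmx //.
  by have := Mlam (invmx M *m x); rewrite mul_scalar_mx dotZr.
Qed.

End TraceGain.

(** Both gains are compared with the quantity of [mxtrace_innov_le]: at [N] the
    lower bound [mu] is used, and at [M] the upper bound [lam]. *)
Lemma trace_gain_ratio (R : realType) (p n : nat) (Q : 'M[R]_p)
    (L : 'M[R]_(p, n)) (M N : 'M[R]_n) mu lam :
  posdefmx Q -> posdefmx M -> posdefmx N -> loewner M N ->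
  loewner mu%:M N -> loewner M lam%:M ->
  mu * (\tr (invmx N) - \tr (invmx (N + L^T *m invmx Q *m L))) <=
  lam * (\tr (invmx M) - \tr (invmx (M + L^T *m invmx Q *m L))).
Proof.
move=> pQ pM pN MN muN Mlam; rewrite !trace_gainE //.
have Nlam := loewner_lambda_max (psdmx_sym (posdefmx_psd pN)).
have muM := lambda_min_loewner (psdmx_sym (posdefmx_psd pM)).
have [lo _] := mxtrace_innov_bounds L pQ pN muN Nlam.
have [_ hi] := mxtrace_innov_bounds L pQ pM muM Mlam.
apply: le_trans lo (le_trans _ hi).
exact: mxtrace_innov_le.
Qed.

(** * Greedy minimization *)

Section Greedy.
Variables (R : realType) (O : finType) (f : {set O} -> R) (alpha : R).
Hypothesis alpha_ge0 : 0 <= alpha.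
Hypothesis f0 : f finset.set0 = 0.
Hypothesis f_mono : forall A B : {set O}, A \subset B -> f B <= f A.
Hypothesis f_ratio : forall (A B : {set O}) u, A \subset B -> u \notin B ->
  alpha * (f B - f (u |: B)%SET) <= f A - f (u |: A)%SET.

(** Adding the elements of [T] one at a time to [A], each marginal gain is
    compared with the gain of the same element at [A] itself; an element
    that is already present adds [0] on the left. *)
Lemma ratio_union (A T : {set O}) :
  alpha * (f A - f (A :|: T)%SET) <= \sum_(u in T) (f A - f (u |: A)%SET).
Proof.
rewrite -big_enum -[in X in X <= _](set_enum T) /=.
elim: (enum T) => [|u l IH].
  rewrite big_nil; have -> : [set x in [::]]%SET = finset.set0 :> {set O}.
    by apply/setP => x; rewrite !inE.
  by rewrite finset.setU0 subrr mulr0.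
rewrite big_cons; pose B := (A :|: [set x in l])%SET.
have -> : (A :|: [set x in u :: l] = u |: B)%SET.
  by apply/setP => x; rewrite !inE orbCA.
have AB : A \subset B by apply: finset.subsetUl.
have [uB|uB] := boolP (u \in B).
  rewrite (finset.setUidPr _) ?finset.sub1set //; apply: le_trans IH _.
  by rewrite lerDr subr_ge0 f_mono // finset.subsetUr.
rewrite -[f A - _](subrKA (f B)) mulrDr addrC lerD //.
exact: f_ratio.
Qed.

(** The gap to [T] is multiplied by at most [1 - alpha / s] at each step, and
    [1 - t <= exp (- t)]. Once the gap is negative it remains so by
    monotonicity; treating this case apart means that [1 - alpha / s] may
    be negative. *)
Lemma greedy_bound s r (G T : {set O}) : (0 < s)%N -> (#|T| <= s)%N ->
  greedy_solution f r G ->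
  f G <= (1 - expR (- (alpha * r%:R / s%:R))) * f T.
Proof.
move=> s0 Ts; have fT0 : f T <= 0 by rewrite -f0 f_mono ?finset.sub0set.
suff H : greedy_solution f r G ->
    f G - f T <= expR (- (alpha * r%:R / s%:R)) * - f T.
  by move=> /H; lra.
elim=> {r G} [|j G u _ IH uG umin].
  by rewrite mulr0 mul0r oppr0 expR0 f0 mul1r sub0r.
have Gu : f (u |: G)%SET <= f G by rewrite f_mono // finset.subsetUr.
have [d_lt0|d_ge0] := ltP (f G - f T) 0.
  rewrite (@le_trans _ _ 0) //; last by rewrite mulr_ge0 ?expR_ge0 ?oppr_ge0.
  by apply: le_trans (ltW d_lt0); rewrite lerD2r.
have step : alpha * (f G - f T) <= s%:R * (f G - f (u |: G)%SET).
  apply: (@le_trans _ _ (alpha * (f G - f (G :|: T)%SET))).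
    by rewrite ler_wpM2l // lerD2l lerN2 f_mono // finset.subsetUr.
  apply: le_trans (ratio_union G T) _.
  apply: (@le_trans _ _ (\sum_(w in T) (f G - f (u |: G)%SET))).
    apply: ler_sum => w _; rewrite lerD2l lerN2.
    have [wG|wG] := boolP (w \in G); last exact: umin.
    by rewrite [(w |: G)%SET](finset.setUidPr _) ?finset.sub1set.
  rewrite sumr_const -[X in X <= _]mulr_natl ler_wpM2r ?ler_nat //.
  by rewrite subr_ge0.
have s_gt0 : 0 < s%:R :> R by rewrite ltr0n.
apply: (@le_trans _ _ (expR (- (alpha / s%:R)) * (f G - f T))).
  apply: (@le_trans _ _ ((1 + - (alpha / s%:R)) * (f G - f T))).
    rewrite mulrDl mul1r mulNr mulrAC.
    have : alpha * (f G - f T) / s%:R <= f G - f (u |: G)%SET.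
      by rewrite ler_pdivrMr // mulrC (mulrC _ s%:R) // mulrC.
    by lra.
  by rewrite ler_wpM2r // expR_ge1Dx.
have -> : - (alpha * j.+1%:R / s%:R) =
    - (alpha / s%:R) + - (alpha * j%:R / s%:R).
  by rewrite -natr1; ring.
by rewrite expRD -mulrA ler_wpM2l ?expR_ge0.
Qed.

End Greedy.

(** * Filtering covariances *)

Section Filtering.
Variables (R : realType) (n : nat) (O : finType).
Variable Sys : linear_system R n O.
Variable Pest : nat -> 'M[R]_n.
Hypothesis hPest : forall j : nat, psdmx (Pest j).

Local Notation Pr := (Ppred Sys Pest).
Local Notation Pf := (Pfilt Sys Pest).
Local Notation W X := (\sum_(u in X) V Sys u).

Lemma posdefmx_Ppred k : posdefmx (Pr k).
Proof.
case: k => [|j] /=; first exact: Pi0_posdef.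
rewrite addrC; apply: posdefmxD; first exact: Rw_posdef.
exact: psdmx_congr.
Qed.

Lemma psdmx_V u : psdmx (V Sys u).
Proof.
rewrite /V -[X in _ *m X]trmxK; apply: psdmx_congr.
exact/posdefmx_psd/posdefmx_inv/Rv_posdef.
Qed.

(** The information matrix, that is, the inverse of the filtering covariance. *)
Definition info k (X : {set O}) := invmx (Pr k) + W X.

Lemma posdefmx_info k X : posdefmx (info k X).
Proof.
apply: posdefmxD; first exact/posdefmx_inv/posdefmx_Ppred.
by apply: psdmx_sum => u; apply: psdmx_V.
Qed.

Lemma posdefmx_Pfilt k X : posdefmx (Pf k X).
Proof. exact/posdefmx_inv/posdefmx_info. Qed.

Lemma info0 k : info k finset.set0 = invmx (Pr k).
Proof. by rewrite /info big_set0 addr0. Qed.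

Lemma Pfilt0 k : Pf k finset.set0 = Pr k.
Proof. by rewrite /Pfilt -/(info _ _) info0 invmxK. Qed.

Lemma info_loewner k (A B : {set O}) :
  A \subset B -> loewner (info k A) (info k B).
Proof.
move=> AB; rewrite {2}/info (big_setID A) /= (finset.setIidPr AB) addrA.
by apply: loewner_addr; apply: psdmx_sum => u; apply: psdmx_V.
Qed.

Lemma Pfilt_loewner k (A B : {set O}) :
  A \subset B -> loewner (Pf k B) (Pf k A).
Proof.
by move=> AB; apply: loewner_inv; [exact: posdefmx_info..|exact: info_loewner].
Qed.

Lemma trace_Pfilt_le k (A B : {set O}) :
  A \subset B -> \tr (Pf k B) <= \tr (Pf k A).
Proof.
move=> AB; rewrite -[Pf k B]mul1mx -[Pf k A]mul1mx; apply: mxtrace_loewner.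
- exact/posdefmx_psd/posdefmx_scalar.
- exact/psdmx_sym/posdefmx_psd/posdefmx_Pfilt.
- exact/psdmx_sym/posdefmx_psd/posdefmx_Pfilt.
exact: Pfilt_loewner.
Qed.

Lemma spectral_norm_Pfilt_le k (X : {set O}) :
  spectral_norm (Pf k X) <= spectral_norm (Pr k).
Proof.
have psdP := posdefmx_psd (posdefmx_Ppred k).
apply: spectral_norm_le.
- exact/posdefmx_psd/posdefmx_Pfilt.
- exact: spectral_norm_ge0.
move=> x; apply: le_trans (loewner_spectral_norm psdP x).
by rewrite -(Pfilt0 k); apply: Pfilt_loewner; apply: finset.sub0set.
Qed.

(** With [W] the sum over [X] and [P] the predicted covariance, the variational
    formula for [(P^-1 + W)^-1] at [x], taken at [y = P *m x], reads
    [P - P W P <= (P^-1 + W)^-1]. *)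
Lemma spectral_norm_Ppred_le k (X : {set O}) :
  spectral_norm (Pr k) <= spectral_norm (Pf k X) +
    lambda_max (\sum_u V Sys u) * lambda_max (Pr k) ^+ 2.
Proof.
have pdP := posdefmx_Ppred k; have psdP := posdefmx_psd pdP.
have symP := psdmx_sym psdP.
have psdX : psdmx (Pf k X) by apply/posdefmx_psd/posdefmx_Pfilt.
have psdV : psdmx (\sum_u V Sys u) by apply: psdmx_sum => u; apply: psdmx_V.
have lV := lambda_max_ge0 psdV; have lP := lambda_max_ge0 psdP.
apply: spectral_norm_le => //.
  by rewrite addr_ge0 ?spectral_norm_ge0 // mulr_ge0 // exprn_ge0.
apply/loewner_scalarP => x; rewrite mulrDl -mulrA.
have /loewner_scalarP/(_ x) sX := loewner_spectral_norm psdX.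
have sqP := psdmx_sqr_le x psdP lP (loewner_lambda_max symP).
have /loewner_scalarP/(_ (Pr k *m x)) VP := loewner_lambda_max (psdmx_sym psdV).
have WV : dot (Pr k *m x) (W X *m (Pr k *m x)) <=
    dot (Pr k *m x) ((\sum_u V Sys u) *m (Pr k *m x)).
  rewrite -[X in _ <= dot _ (X *m _)](_ : W [set: O]%SET = _); last first.
    by apply: eq_bigl => u; rewrite inE.
  have := info_loewner k (finset.subsetT X) (Pr k *m x).
  by rewrite !mulmxDl !dotDr lerD2l.
have := invmx_variational x (Pr k *m x) (posdefmx_info k X).
rewrite -/(Pf k X) /info mulmxDl dotDr mulKmx ?posdefmx_unit //.
rewrite (dotC (Pr k *m x)) mulr2n.
have := ler_wpM2l lV sqP; lra.
Qed.

Lemma alpha_hat_ge0 m k : 0 <= alpha_hat Sys Pest m k.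
Proof.
rewrite divr_ge0 ?lambda_min_ge0 ?lambda_max_ge0 //.
  exact/posdefmx_psd/posdefmx_inv/posdefmx_Ppred.
apply: psdmxD; last by apply: psdmx_sum => u; apply: psdmx_V.
exact/posdefmx_psd/posdefmx_inv/posdefmx_Ppred.
Qed.

Lemma trace_Pfilt_ratio m k (A B : {set O}) u : A \subset B -> u \notin B ->
  alpha_hat Sys Pest m k *
    (\tr (Pf (m + k) B) - \tr (Pf (m + k) (u |: B)%SET)) <=
  \tr (Pf (m + k) A) - \tr (Pf (m + k) (u |: A)%SET).
Proof.
move=> AB uB.
have uA : u \notin A by apply: contra uB; apply: (fintype.subsetP AB).
set j := (m + k)%N.
have gain_ge0 : 0 <= \tr (Pf j A) - \tr (Pf j (u |: A)%SET).
  by rewrite subr_ge0 trace_Pfilt_le // finset.subsetUr.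
have infoU (X : {set O}) : u \notin X ->
    info j (u |: X)%SET = info j X + V Sys u.
  by move=> uX; rewrite /info big_setU1 //= addrA addrAC.
have infoT : invmx (Pr j) + \sum_v V Sys v = info j [set: O]%SET.
  by congr (_ + _); apply: eq_bigl => v; rewrite inE.
have pdI := posdefmx_info j.
have sI X := psdmx_sym (posdefmx_psd (pdI X)).
have muB : loewner (lambda_min (invmx (Pr j)))%:M (info j B).
  move=> x; apply: le_trans (lambda_min_loewner _ x) _.
    by rewrite -info0.
  by rewrite -info0; apply: info_loewner; apply: finset.sub0set.
have lamA : loewner (info j A) (lambda_max (info j [set: O]%SET))%:M.
  move=> x; apply: le_trans (loewner_lambda_max (sI _) x).
  by apply: info_loewner; apply: finset.subsetT.
have := trace_gain_ratio (H Sys u) (Rv_posdef Sys u) (pdI A) (pdI B)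
  (info_loewner j AB) muB lamA.
rewrite -/(V Sys u) -!infoU // /alpha_hat -/j infoT.
have := lambda_max_ge0 (posdefmx_psd (pdI [set: O]%SET)).
rewrite le_eqVlt => /orP[/eqP<-|lam0].
  (* only for [n = 0]: the quotient defining [alpha_hat] is then [0] *)
  by rewrite invr0 mulr0 mul0r.
by rewrite mulrAC ler_pdivrMr // (mulrC _ (lambda_max _)).
Qed.

Variables (N m : nat) (theta : nat -> R).
Hypothesis htheta : forall k : nat, (k < N)%N -> 0 <= theta k.

Lemma f_traceB (A B : {set O}) :
  f_trace Sys Pest N m theta A - f_trace Sys Pest N m theta B =
  \sum_(k < N) theta k * (\tr (Pf (m + k) A) - \tr (Pf (m + k) B)).
Proof.
rewrite /f_trace -sumrB; apply: eq_bigr => k _.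
by rewrite -mulrBr opprB addrA subrK.
Qed.

Lemma f_trace0 : f_trace Sys Pest N m theta finset.set0 = 0.
Proof.
by rewrite /f_trace big1 // => k _; rewrite Pfilt0 subrr mulr0.
Qed.

Lemma f_trace_mono (A B : {set O}) : A \subset B ->
  f_trace Sys Pest N m theta B <= f_trace Sys Pest N m theta A.
Proof.
move=> AB; rewrite -subr_ge0 f_traceB; apply: sumr_ge0 => k _.
by rewrite mulr_ge0 ?htheta // subr_ge0 trace_Pfilt_le.
Qed.

Lemma f_trace_ratio alpha (A B : {set O}) u :
  (forall k, (k < N)%N -> alpha <= alpha_hat Sys Pest m k) ->
  A \subset B -> u \notin B ->
  alpha * (f_trace Sys Pest N m theta B -
           f_trace Sys Pest N m theta (u |: B)%SET) <=
  f_trace Sys Pest N m theta A - f_trace Sys Pest N m theta (u |: A)%SET.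
Proof.
move=> alphale AB uB; rewrite !f_traceB mulr_sumr; apply: ler_sum => k _.
rewrite mulrCA ler_wpM2l ?htheta //.
apply: le_trans (trace_Pfilt_ratio m k AB uB).
by rewrite ler_wpM2r ?alphale // subr_ge0 trace_Pfilt_le // finset.subsetUr.
Qed.

Lemma f_spectral_le0 X : f_spectral Sys Pest N m theta X <= 0.
Proof.
apply: sumr_le0 => k _; rewrite mulr_ge0_le0 ?htheta // subr_le0.
exact: spectral_norm_Pfilt_le.
Qed.

Lemma f_spectral_ge X :
  - (\sum_(k < N) theta k * epsilon_hat Sys Pest m k) <=
  f_spectral Sys Pest N m theta X.
Proof.
rewrite -sumrN; apply: ler_sum => k _; rewrite -mulrN ler_wpM2l ?htheta //.
have := spectral_norm_Ppred_le (m + k) X; rewrite -/(epsilon_hat Sys Pest m k).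
by lra.
Qed.

Lemma epsilon_hat_ge0 k : 0 <= epsilon_hat Sys Pest m k.
Proof.
rewrite mulr_ge0 ?exprn_ge0 ?lambda_max_ge0 //.
  by apply: psdmx_sum => u; apply: psdmx_V.
exact/posdefmx_psd/posdefmx_Ppred.
Qed.

End Filtering.

(** * The greedy guarantees *)

Theorem theorem5 (R : realType) (n : nat) (O : finType)
    (Sys : linear_system R n O)
    (Pest : nat -> 'M[R]_n) (hPest : forall j : nat, psdmx (Pest j))
    (N m : nat) (hN : (1 <= N)%N)
    (theta : nat -> R) (htheta : forall k : nat, (k < N)%N -> 0 <= theta k)
    (s : nat) (hs : (1 <= s)%N) (r : nat) (hr : (r <= #|O|)%N)
    (Tstar Sstar Tg Sg : {set O})
    (hTstar : is_argmin_card (f_trace Sys Pest N m theta) s Tstar)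
    (hSstar : is_argmin_card (f_spectral Sys Pest N m theta) s Sstar)
    (hTg : greedy_solution (f_trace Sys Pest N m theta) r Tg)
    (hSg : greedy_solution (f_spectral Sys Pest N m theta) r Sg) :
  (exists alpha : R,
     \big[Num.min/alpha_hat Sys Pest m 0]_(k < N) alpha_hat Sys Pest m k
       <= alpha /\
     f_trace Sys Pest N m theta Tg <=
       (1 - expR (- (alpha * r%:R / s%:R))) * f_trace Sys Pest N m theta Tstar)
  /\
  (exists epsilon : R,
     epsilon <= \sum_(k < N) theta k * epsilon_hat Sys Pest m k /\
     f_spectral Sys Pest N m theta Sg <=
       (1 - expR (- (r%:R / s%:R))) *
         (f_spectral Sys Pest N m theta Sstar + s%:R * epsilon)).
Proof.
split.
  set alpha := \big[_/_]_(_ < _) _; exists alpha; split=> //.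
  have alphale k : (k < N)%N -> alpha <= alpha_hat Sys Pest m k.
    by move=> kN; apply: (bigmin_le _ (Ordinal kN)).
  apply: greedy_bound hTg => //.
  - by apply: le_bigmin => [|k _]; apply: alpha_hat_ge0.
  - exact: f_trace0.
  - exact: f_trace_mono.
  - by move=> A B u; apply: f_trace_ratio.
  - by case: hTstar.
set epsilon := \sum_(k < N) _; exists epsilon; split=> //.
apply: le_trans (f_spectral_le0 Sys hPest m htheta Sg) _; apply: mulr_ge0.
  by rewrite subr_ge0 -expR0 ler_expR oppr_le0 divr_ge0.
have eps_ge0 : 0 <= epsilon.
  by apply: sumr_ge0 => k _; rewrite mulr_ge0 ?htheta ?epsilon_hat_ge0.
rewrite -lerBlDr sub0r.
apply: le_trans (f_spectral_ge Sys hPest m htheta Sstar).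
by rewrite lerN2 ler_peMl // ler1n.
Qed.
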